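(* Let $p>1$ and $0<u<p$ be real and $d$ a positive integer such that \[ \frac{1}{(u/p)_d}=\prod_{i=1}^d\left(1-\frac{u}{p^i}\right)^{-1}<2. \] If $\nu$ is any probability measure on the set of partitions such that for every partition $\mu$ \[ \sum_\lambda\nu(\lambda)\,|{\rm Sur}(\lambda,\mu)|=\begin{cases}\dfrac{u^{|\mu|}(1/p)_d}{(1/p)_{d-r(\mu)}} & \text{if } r(\mu)\le d,\\ 0 & \text{otherwise},\end{cases} \] then $\nu=P_{d,u}$.
   Context: Write $(x)_i=(1-x)(1-x/p)\cdots(1-x/p^{i-1})$ (with $(x)_0=1$). For a partition $\lambda$: $|\lambda|=\sum\lambda_i$, $m_i(\lambda)$ is the number of parts equal to $i$, $\lambda_i'$ is the length of the $i$-th column of its diagram, and $r(\lambda)=\lambda_1'$ its number of parts. $P_{d,u}(\lambda)=\frac{u^{|\lambda|}}{p^{\sum_i(\lambda_i')^2}\prod_i (1/p)_{m_i(\lambda)}}\prod_{i=1}^d(1-u/p^i)\prod_{i=d-r(\lambda)+1}^d(1-1/p^i)$ if $r(\lambda)\le d$, and $0$ otherwise. Set $|{\operatorname{Aut}}(\mu)|=p^{\sum_i(\mu_i')^2}\prod_i(1/p)_{m_i(\mu)}$. For a prime $\ell$, the number of subgroups of type $\mu$ in a finite abelian $\ell$-group of type $\lambda$ (i.e. isomorphic to $\prod_i\mathbb{Z}/\ell^{\lambda_i}\mathbb{Z}$) is a polynomial $n_\lambda(\mu)$ evaluated at $\ell$; for real $p>1$, $n_\lambda(\mu)$ denotes this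 polynomial evaluated at $p$, and $|{\rm Sur}(\lambda,\mu)|:=n_\lambda(\mu)|{\operatorname{Aut}}(\mu)|$. When $p$ is prime this is the number of surjective homomorphisms from a finite abelian $p$-group of type $\lambda$ onto one of type $\mu$. *)

(* Defs.v *)
From HB Require Import structures.
From mathcomp Require Import all_boot all_order all_algebra all_fingroup.
From mathcomp Require Import all_classical all_reals all_analysis.

Set Implicit Arguments.
Unset Strict Implicit.
Unset Printing Implicit Defensive.

Import Order.TTheory GRing.Theory Num.Theory.

Local Open Scope classical_set_scope.
Local Open Scope ring_scope.

Definition is_partition (s : seq nat) : bool :=
  sorted geq s && all (leq 1) s.

Record intpart : predArgType :=
  IntPart { parts :> seq nat; partsP : is_partition parts }.

HB.instance Definition _ := [isSub for parts].
HB.instance Definition _ := [Countable of intpart by <:].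

Definition empty_intpart : intpart := @IntPart [::] isT.
HB.instance Definition _ := isPointed.Build intpart empty_intpart.

HB.instance Definition _ := @isMeasurable.Build default_measure_display
  intpart discrete_measurable discrete_measurable0
  discrete_measurableC discrete_measurableU.

Definition psize (la : intpart) : nat := sumn la.
Definition pmult (la : intpart) (i : nat) : nat := count_mem i la.
(* Length of the i-th column, for i >= 1. *)
Definition pcol (la : intpart) (i : nat) : nat := count (leq i) la.
Definition prank (la : intpart) : nat := pcol la 1.

Section counting.
Local Open Scope group_scope.

(* prod_i Z/l^(la_i); the parts are positive, so for l prime the moduli are at
   least 2 and 'Z_(l ^ la_i) is the ring of integers modulo l ^ la_i. *)
Definition abgroup (l : nat) (la : intpart) : finGroupType :=
  {dffun forall i : 'I_(size la), 'Z_(l ^ nth 0 la i)%N}.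

Definition num_subgroups (l : nat) (la mu : intpart) : nat :=
  #|[set H : {group abgroup l la} | H \isog [set: abgroup l mu]]%SET|.

End counting.

Section measures.
Variable R : realType.
Implicit Types (p u x : R) (d : nat) (la mu : intpart).

Definition subgroup_poly_spec la mu : set {poly R} :=
  [set P | forall l : nat, prime l -> P.[l%:R] = (num_subgroups l la mu)%:R].

(* The polynomial meeting the specification; it is unique because there are
   infinitely many primes, and exists by Hall. *)
Definition subgroup_poly la mu : {poly R} :=
  xget 0 (subgroup_poly_spec la mu).

Definition nsub p la mu : R := (subgroup_poly la mu).[p].

Definition poch p x (n : nat) : R := \prod_(0 <= j < n) (1 - x / p ^+ j).

(* Columns and multiplicities of index greater than |la| vanish, so stopping
   at i = |la| loses nothing. *)
Definition card_aut p la : R :=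
  p ^+ (\sum_(1 <= i < (psize la).+1) pcol la i ^ 2)%N
  * \prod_(1 <= i < (psize la).+1) poch p (1 / p) (pmult la i).

Definition card_sur p la mu : R := nsub p la mu * card_aut p mu.

Definition Pdu p u d la : R :=
  if (prank la <= d)%N then
    u ^+ psize la / card_aut p la
    * \prod_(1 <= i < d.+1) (1 - u / p ^+ i)
    * \prod_((d - prank la).+1 <= i < d.+1) (1 - 1 / p ^+ i)
  else 0.

Definition sur_moment p u d mu : R :=
  if (prank mu <= d)%N then
    u ^+ psize mu * poch p (1 / p) d / poch p (1 / p) (d - prank mu)
  else 0.

End measures.

(* Main.v *)
(** A group of type mu embeds into a finite abelian l-group G of type la exactly
    when its generators, taken in decreasing order of the parts of mu, are sent
    one after the other to independent elements; each new generator x, of order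
    l^m, only has to satisfy x^(l^m) = 1 and x^(l^(m-1)) outside the subgroup
    already generated.  This gives a product formula for the number of
    injections, and Hall's polynomial is its quotient by the same formula for
    la = mu, a product of Gaussian binomials.  Hence |Sur(la, mu)| is the product
    formula at every real p > 1.

    Removing the first column of la and mu multiplies the formula by an explicit
    factor, so the moments of P_{d,u} are computed column by column, each step
    being a finite q-series identity of Durfee-rectangle type; for mu empty the
    recursion is a fixed point equation instead.

    Finally let C = prod_(i <= d) (1 - u/p^i) and let M be the moments.  As
    P_{d,u}(la) |Aut la| = C M_la, a bound |nu - P_{d,u}| |Aut| <= K M improves to
    |nu - P_{d,u}| |Aut| <= K (1/C - 1) M, and 1/C - 1 < 1. *)
Require Import Defs.
From HB Require Import structures.
From mathcomp Require Import all_boot all_order all_algebra all_fingroup.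
From mathcomp Require Import all_solvable zify ring lra.

Set Implicit Arguments.
Unset Strict Implicit.
Unset Printing Implicit Defensive.

Import Order.TTheory GRing.Theory Num.Theory.

(** * Independent generators in a finite abelian l-group *)

Section bases.
Local Open Scope nat_scope.
Local Open Scope group_scope.
Local Open Scope set_scope.
Variables (l : nat) (gT : finGroupType).
Implicit Types (x y : gT) (mu : seq nat) (xs : seq gT).

(* Generators are listed with the smallest order first: [x] is independent of the
   subgroup generated by [xs'] as soon as its multiple of order l is outside. *)
Fixpoint basis mu xs : bool :=
  match mu, xs with
  | [::], [::] => true
  | m :: mu', x :: xs' =>
      [&& basis mu' xs', x ^+ (l ^ m)%N == 1
        & x ^+ (l ^ m.-1)%N \notin <<[set y in xs']>>]
  | _, _ => false
  end.

Hypotheses (l_pr : prime l) (cT : abelian [set: gT]) (lT : l.-group [set: gT]).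

Lemma subset_abelian (A : {set gT}) : abelian A.
Proof. exact: abelianS (subsetT _) cT. Qed.

Lemma subgroup_pgroup (A : {group gT}) : l.-group A.
Proof. exact: pgroupS (subsetT _) lT. Qed.

Lemma order_basis_head m x (H : {group gT}) : (0 < m)%N ->
  x ^+ (l ^ m)%N = 1 -> x ^+ (l ^ m.-1)%N \notin H -> #[x] = (l ^ m)%N.
Proof.
move=> m_gt0 xm xNH.
have /dvdn_pfactor - /(_ l_pr) [k km ok] : #[x] %| (l ^ m)%N by rewrite order_dvdn xm.
rewrite ok; congr (_ ^ _)%N; apply/eqP; rewrite eqn_leq km leqNgt.
apply: contra xNH => ltk.
have -> : x ^+ (l ^ m.-1)%N = 1; last exact: group1.
by apply/eqP; rewrite -order_dvdn ok dvdn_exp2l // -ltnS prednK.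
Qed.

(** A nontrivial intersection of [<[x]>] with [H] would contain the only subgroup of order l of the
    cyclic group [<[x]>]. That subgroup is generated by [x ^+ (l ^ m.-1)], which lies outside
    [H]. *)
Lemma dprod_basis_head m x (H : {group gT}) : (0 < m)%N ->
    x ^+ (l ^ m)%N = 1 -> x ^+ (l ^ m.-1)%N \notin H ->
  <[x]> \x H = <<x |: H>>.
Proof.
move=> m_gt0 xm xNH; have ox := order_basis_head m_gt0 xm xNH.
have -> : <<x |: H>> = <[x]> <*> H by rewrite /cycle joing_idl.
rewrite dprodEY //.
  exact: subset_trans (subsetT _) (subset_trans cT (centS (subsetT _))).
apply/eqP; apply: contraNT xNH => nt.
have lK : l %| #|<[x]> :&: H|.
  by case: (pgroup_pdiv (subgroup_pgroup [group of <[x]> :&: H]) nt).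
have ox' : #[x ^+ (l ^ m.-1)%N] = l.
  rewrite orderXdiv ox ?dvdn_exp2l ?leq_pred //.
  by rewrite -[in (l ^ m)%N](prednK m_gt0) expnS mulnK // expn_gt0 prime_gt0.
have := @cardSg_cyclic _ <[x]> <[x ^+ (l ^ m.-1)%N]> (<[x]> :&: H)%G (cycle_cyclic x).
rewrite cycleX subsetIl => /(_ isT isT) /=.
rewrite [#|<[_ ^+ _]>|]ox' lK => /esym /subsetP/(_ _ (cycle_id _)).
by rewrite inE => /andP[].
Qed.

Lemma basis_cons_dprod m mu x xs : (0 < m)%N -> basis (m :: mu) (x :: xs) ->
  <[x]> \x <<[set y in xs]>> = <<[set y in x :: xs]>>.
Proof.
move=> m_gt0 /= /and3P[_ /eqP xm xN].
rewrite (dprod_basis_head m_gt0 xm xN) set_cons.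
exact: joing_idr.
Qed.

Lemma basis_order mu xs : all (leq 1) mu -> basis mu xs ->
  map order xs = [seq (l ^ m)%N | m <- mu].
Proof.
elim: mu xs => [|m mu IH] [|x xs] //= /andP[m0 mu0] /and3P[b /eqP xm xN].
by rewrite (order_basis_head m0 xm xN) IH.
Qed.

Lemma basis_bigdprod mu xs : all (leq 1) mu -> basis mu xs ->
  \big[dprod/1]_(x <- xs) <[x]> = <<[set y in xs]>>.
Proof.
elim: mu xs => [|m mu IH] [|x xs] //=; first by rewrite big_nil set_nil gen0.
move=> /andP[m0 mu0] b; have /and3P[b' _ _] := b.
by rewrite big_cons (IH _ mu0 b') (basis_cons_dprod m0 b).
Qed.

(** ['Ohm_k] commutes with direct products, and in a cyclic group of order l^m it has order l^(min k
    m). *)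
Lemma basis_card_Ohm mu xs k : all (leq 1) mu -> basis mu xs ->
  #|'Ohm_k(<<[set y in xs]>>)| = (l ^ \sum_(m <- mu) minn k m)%N.
Proof.
elim: mu xs => [|m mu IH] [|x xs] //=.
  by rewrite big_nil set_nil gen0 Ohm1 cards1.
move=> /andP[m0 mu0] b; have /and3P[b' /eqP xm xN] := b.
have ox := order_basis_head m0 xm xN.
rewrite -(dprod_card (Ohm_dprod k (basis_cons_dprod m0 b))) (IH _ mu0 b').
rewrite big_cons expnD; congr (_ * _)%N.
have lx : l.-elt x by apply: (mem_p_elt (subgroup_pgroup _) (cycle_id _)).
rewrite (Ohm_p_cycle _ lx) ox pfactorK //.
rewrite -orderE orderXdiv ox ?dvdn_exp2l ?leq_subr //.
by rewrite -expnB ?prime_gt0 ?leq_subr //; congr (_ ^ _)%N; lia.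
Qed.

Lemma basis_card mu xs : all (leq 1) mu -> basis mu xs ->
  #|<<[set y in xs]>>| = (l ^ sumn mu)%N.
Proof.
move=> mu0 b; rewrite -(bigdprod_card (basis_bigdprod mu0 b)).
have := basis_order mu0 b; elim: mu xs {mu0 b} => [|m mu IH] [|x xs] //=.
  by rewrite big_nil.
by case=> ox /IH oxs; rewrite big_cons oxs -orderE ox expnD.
Qed.

(** In a cyclic factor of order l^k with m <= k, the elements of order l are l^(k-1)-th powers,
    hence l^(m-1)-th powers. *)
Lemma basis_Ohm1_Mho m mu xs : (0 < m)%N -> all (leq m) mu -> basis mu xs ->
  'Ohm_1(<<[set y in xs]>>) \subset 'Mho^m.-1(<<[set y in xs]>>).
Proof.
move=> m0; elim: mu xs => [|k mu IH] [|x xs] //=.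
  by rewrite set_nil gen0 Ohm1 sub1G.
move=> /andP[mk mum] b; have /and3P[b' /eqP xm xN] := b.
have k0 : (0 < k)%N by apply: leq_trans mk.
have ox := order_basis_head k0 xm xN.
have lx : l.-elt x by apply: (mem_p_elt (subgroup_pgroup _) (cycle_id _)).
have /dprodW <- := Ohm_dprod 1 (basis_cons_dprod k0 b).
have /dprodW <- := Mho_dprod m.-1 (basis_cons_dprod k0 b).
apply: mulgSS; last exact: IH.
rewrite (Ohm_p_cycle _ lx) (Mho_p_cycle _ lx) ox pfactorK // cycle_subG.
have -> : (k - 1 = m.-1 + (k - m))%N by lia.
by rewrite expnD expgM mem_cycle.
Qed.

(** In an abelian group the nonempty fibres of the power map are cosets of its kernel. *)
Lemma card_power_preim n (A : {set gT}) : A \subset [set x ^+ n | x : gT] ->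
  #|[set x | x ^+ n \in A]| = (#|A| * #|[set x : gT | x ^+ n == 1%g]|)%N.
Proof.
move=> /subsetP sA; rewrite -sum1_card (partition_big (fun x => x ^+ n) (mem A)) /=;
  last by move=> x; rewrite inE.
rewrite -sum_nat_const; apply: eq_bigr => y yA.
have /imsetP[z _ yE] := sA y yA.
rewrite -sum1_card (reindex_inj (mulgI z)) /=; apply: eq_bigl => x.
rewrite !inE expgMn; last exact: (centsP cT).
rewrite -yE -[RHS](inj_eq (mulgI y)) mulg1.
by case: eqP => [->|]; rewrite ?yA ?andbF.
Qed.

Lemma Ohm_setT k : 'Ohm_k([set: gT]) = [set x | x ^+ (l ^ k)%N == 1].
Proof.
rewrite (OhmEabelian lT (subset_abelian _)); apply/setP=> x.
by rewrite !inE.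
Qed.

(** Let H be the subgroup already generated. An x killed by l^m is rejected exactly when its
    l^(m-1)-th power lands in ['Ohm_1(H)]. This group has order l^(size mu) and consists of
    l^(m-1)-th powers, so the rejected x are counted fibre by fibre. *)
Lemma card_basis_head m mu xs : (0 < m)%N -> all (leq m) mu -> basis mu xs ->
  (#|[set x | x ^+ (l ^ m)%N == 1%g & x ^+ (l ^ m.-1)%N \notin <<[set y in xs]>>]|
    + l ^ size mu * #|'Ohm_m.-1([set: gT])|)%N = #|'Ohm_m([set: gT])|.
Proof.
move=> m0 mum b; set H := <<_>>.
have mu0 : all (leq 1) mu by apply: sub_all mum => k; apply: leq_trans.
have -> : (l ^ size mu)%N = #|'Ohm_1(H)|.
  rewrite (basis_card_Ohm 1 mu0 b); congr (_ ^ _)%N.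
  elim: mu mu0 {mum b} => [|k mu IH] /=; first by rewrite big_nil.
  by case/andP=> k0 /IH->; rewrite big_cons; lia.
rewrite Ohm_setT -card_power_preim; last first.
  apply: subset_trans (basis_Ohm1_Mho m0 mum b) _.
  rewrite (MhoEabelian _ (subgroup_pgroup _) (subset_abelian _)).
  by apply/subsetP=> _ /imsetP[x _ ->]; apply: imset_f.
rewrite Ohm_setT addnC -[RHS](cardsID [set x | x ^+ (l ^ m.-1)%N \in H]).
congr (_ + _)%N; apply: eq_card => x; rewrite !inE; last by rewrite andbC.
rewrite (OhmEabelian (subgroup_pgroup _) (subset_abelian _)) !inE /= andbC.
congr (_ && _).
by rewrite -expgM expn1 -expnSr prednK.
Qed.

Definition nbases mu := #|[set t : (size mu).-tuple gT | basis mu t]|.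

(** The number [c] of ways to add one generator is the same for every basis of type [mu]. The
    formula for [c] is guarded by the existence of such a basis, since otherwise the subtraction
    defining it may truncate. *)
Lemma nbases_cons m mu : (0 < m)%N -> all (leq m) mu -> exists c : nat,
  nbases (m :: mu) = (c * nbases mu)%N /\
  ((0 < nbases mu)%N ->
    (c + l ^ size mu * #|'Ohm_m.-1([set: gT])|)%N = #|'Ohm_m([set: gT])|).
Proof.
move=> m0 mum.
pose c := (#|'Ohm_m([set: gT])| - l ^ size mu * #|'Ohm_m.-1([set: gT])|)%N.
exists c; split; last first.
  case/card_gt0P => t; rewrite inE => b.
  by have := card_basis_head m0 mum b; rewrite /c; lia.
rewrite /nbases -sum1_card.
pose h (q : (size mu).-tuple gT * gT) : (size (m :: mu)).-tuple gT :=
  [tuple of q.2 :: q.1].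
have hK : bijective h.
  exists (fun t : (size mu).+1.-tuple gT => ([tuple of behead t], thead t))
    => [[t x]|t].
    by congr pair; apply: val_inj.
  by rewrite /h /= [RHS]tuple_eta.
rewrite (reindex h) /=; last exact: onW_bij.
rewrite (eq_bigl (fun q : (size mu).-tuple gT * gT => basis mu q.1 && (q.2 \in
  [set x | x ^+ (l ^ m)%N == 1 & x ^+ (l ^ m.-1)%N \notin <<[set y in q.1]>>])));
  last by case=> t x; rewrite !inE.
rewrite -(pair_big_dep (fun t : (size mu).-tuple gT => basis mu t)
  (fun t x => x \in [set x | x ^+ (l ^ m)%N == 1 &
                       x ^+ (l ^ m.-1)%N \notin <<[set y in t]>>]) (fun _ _ => 1%N)) /=.
rewrite mulnC -sum_nat_const; apply: eq_big => t; rewrite ?inE // => b.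
by rewrite sum1_card /c -(card_basis_head m0 mum b) addnK.
Qed.

End bases.

(** * Bases under injective morphisms *)

Section transport.
Local Open Scope nat_scope.
Local Open Scope group_scope.
Local Open Scope set_scope.
Variables (l : nat) (aT rT : finGroupType) (f : {morphism [set: aT] >-> rT}).
Hypothesis injf : 'injm f.

Lemma morphim_seq (xs : seq aT) : f @* [set y in xs] = [set y in map f xs].
Proof.
rewrite morphimEsub ?subsetT //; apply/setP=> z; rewrite inE.
by apply/imsetP/mapP=> -[x] xA ->; exists x => //; rewrite inE in xA *.
Qed.

Lemma morphim_gen_seq (xs : seq aT) :
  f @* <<[set y in xs]>> = <<[set y in map f xs]>>.
Proof. by rewrite morphim_gen ?subsetT // morphim_seq. Qed.

Lemma basis_map mu xs : basis l mu (map f xs) = basis l mu xs.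
Proof.
have fE x n : f (x ^+ n) = f x ^+ n by rewrite morphX ?inE.
have fI : injective f by move=> x y; apply: (injmP injf); rewrite inE.
elim: mu xs => [|m mu IH] [|x xs] //=; rewrite IH -!fE.
rewrite -[1]/(1 : rT) -(morph1 f) (inj_eq fI) -morphim_gen_seq.
by rewrite morphimEsub ?subsetT // (mem_imset _ _ fI).
Qed.

End transport.

(** * Subgroups of a given type counted through their bases *)

Section subgroup_count.
Local Open Scope nat_scope.
Local Open Scope group_scope.
Local Open Scope set_scope.
Variables (l : nat) (aT gT : finGroupType) (mu : seq nat) (es : seq aT).
Hypotheses (l_pr : prime l).
Hypotheses (caT : abelian [set: aT]) (laT : l.-group [set: aT]).
Hypotheses (cgT : abelian [set: gT]) (lgT : l.-group [set: gT]).
Hypotheses (mu0 : all (leq 1) mu) (bes : basis l mu es).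
Hypothesis (ges : <<[set y in es]>> = [set: aT]).

Lemma basis_isog xs : basis l mu xs -> <<[set y in xs : seq gT]>> \isog [set: aT].
Proof.
move=> b.
rewrite eq_abelian_type_isog ?(abelianS (subsetT _) cgT) //.
have no1 (T : finGroupType) (ys : seq T) :
    map order ys = [seq (l ^ m)%N | m <- mu] -> 1%g \notin ys.
  move=> oE; apply/negP=> /(map_f order); rewrite order1 oE => /mapP[m mmu] /eqP.
  rewrite eq_sym -(expn0 l) eqn_exp2l ?prime_gt1 // => /eqP m0.
  by have /(_ _ mmu) := allP mu0; rewrite m0.
have oxs := basis_order l_pr mu0 b; have oes := basis_order l_pr mu0 bes.
have pxs := abelian_type_pgroup (pgroupS (subsetT _) lgT)
  (basis_bigdprod l_pr cgT lgT mu0 b) (no1 _ _ oxs).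
have pes : perm_eq (abelian_type [set: aT]) (map order es).
  apply: (@abelian_type_pgroup _ l es [set: aT]%G laT _ (no1 _ _ oes)).
  by rewrite (basis_bigdprod l_pr caT laT mu0 bes) ges.
apply/eqP; apply: (sorted_eq (leT := geq)); rewrite ?abelian_type_sorted //.
- by move=> ? ? ? /= ? ?; lia.
- by move=> ? ? /= ?; lia.
by rewrite (perm_trans pxs) // oxs -oes perm_sym.
Qed.

Lemma basis_gen_setT xs : basis l mu xs -> <<[set y in xs : seq aT]>> = [set: aT].
Proof.
move=> b; apply/eqP; rewrite eqEcard subsetT /= -ges.
by rewrite (basis_card l_pr caT laT mu0 b) (basis_card l_pr caT laT mu0 bes).
Qed.

(** An isomorphism from [aT] onto [H] carries the bases of [aT] bijectively to the bases that
    generate [H]. *)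
Lemma card_bases_gen (H : {group gT}) : H \isog [set: aT] ->
  #|[set t : (size mu).-tuple gT | basis l mu t & <<[set y in t]>> == H :> {set gT}]|
  = nbases l aT mu.
Proof.
rewrite isog_sym => /isogP[f injf fT].
have fI : injective f by move=> x y; apply: (injmP injf); rewrite inE.
rewrite /nbases
  -(card_imset _ (f := fun t : (size mu).-tuple aT => [tuple of map f t]));
  last by move=> t1 t2 /(congr1 val) /= /(inj_map fI) /val_inj.
apply: eq_card => t; rewrite inE; apply/andP/imsetP => [[b /eqP gt]|[s]].
  pose g := invm injf.
  have fg x : x \in t -> f (g x) = x.
    move=> xt; apply: invmK; rewrite [f @* _]fT -gt mem_gen // inE //.
  have tE : t = [tuple of map f [tuple of map g t]].
    apply: val_inj => /=; rewrite -map_comp -[LHS]map_id.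
    by apply/eq_in_map => x /fg /=.
  exists [tuple of map g t] => //; rewrite inE -(basis_map _ injf).
  by have /(congr1 val) /= <- := tE.
rewrite inE => b ->; split; first by rewrite basis_map.
by rewrite -morphim_gen_seq basis_gen_setT // fT.
Qed.

(** The bases in [gT] are sorted by the subgroup they generate, which is isomorphic to [aT] because
    its generators have the same orders. *)
Lemma nbases_subgroups :
  nbases l gT mu = (#|[set H : {group gT} | H \isog [set: aT]]| * nbases l aT mu)%N.
Proof.
rewrite {1}/nbases -sum1_card.
rewrite (partition_big (fun t : (size mu).-tuple gT => <<[set y in t]>>%G)
  (mem [set H : {group gT} | H \isog [set: aT]])) /=; last first.
  by move=> t; rewrite !inE => /basis_isog.
rewrite -sum_nat_const; apply: eq_bigr => H; rewrite inE => iH.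
rewrite -(card_bases_gen iH) sum1_card; apply: eq_card => t.
by rewrite [LHS]unfold_in /= !inE -val_eqE.
Qed.

End subgroup_count.

(** * The standard group of type la and its canonical basis *)

Section abgroups.
Local Open Scope nat_scope.
Local Open Scope group_scope.
Local Open Scope set_scope.
Variables (l : nat) (la : intpart).
Hypothesis l_pr : prime l.

Lemma part_gt0 (i : 'I_(size la)) : (0 < nth 0 la i)%N.
Proof. by have /andP[_ /allP-> //] := partsP la; rewrite mem_nth. Qed.

Lemma part_modulus_gt1 (i : 'I_(size la)) : (1 < l ^ nth 0 la i)%N.
Proof. by rewrite -(expn0 l) ltn_exp2l ?part_gt0 ?prime_gt1. Qed.

Lemma abgroup_abelian : abelian [set: abgroup l la].
Proof.
apply/centsP=> x _ y _; apply/ffunP=> i; rewrite !mulg_ffun.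
exact: Zp_mulgC.
Qed.

Lemma card_abgroup : #|[set: abgroup l la]| = (l ^ sumn la)%N.
Proof.
rewrite cardsT card_dep_ffun foldrE big_image /=.
under eq_bigr => i _ do rewrite card_ord Zp_cast ?part_modulus_gt1 //.
by rewrite -expn_sum sumnE (big_nth 0%N) big_mkord.
Qed.

Lemma abgroup_pgroup : l.-group [set: abgroup l la].
Proof. by rewrite /pgroup card_abgroup pnatX pnat_id ?orbT. Qed.

Definition abgroup_unit (i : 'I_(size la)) : abgroup l la :=
  @dfung1 _ (fun i : 'I_(size la) => 'Z_(l ^ nth 0 la i)) i (Zp1).

Lemma abgroup_expE (x : abgroup l la) k i : (x ^+ k) i = x i ^+ k.
Proof.
elim: k => [|k IH]; first by rewrite oneg_ffun.
by rewrite !expgS mulg_ffun IH.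
Qed.

Lemma abgroup_unit_exp i k :
  (abgroup_unit i ^+ k == 1) = (l ^ nth 0 la i %| k)%N.
Proof.
have lt1 := part_modulus_gt1 i.
have vE : val (Zp1 ^+ k : 'Z_(l ^ nth 0 la i)) = (k %% l ^ nth 0 la i)%N.
  by rewrite Zp_expg /= Zp_cast // modnMml mul1n.
apply/eqP/idP => [/(congr1 (fun x : abgroup l la => x i))|dv].
  rewrite abgroup_expE dfung1_id oneg_ffun => /(congr1 val).
  by rewrite vE => /eqP.
apply/ffunP=> j; rewrite abgroup_expE oneg_ffun.
case: (eqVneq i j) => [<-|ij]; last by rewrite dfung1_dflt // expg1n.
by rewrite dfung1_id; apply: val_inj; rewrite vE; apply/eqP.
Qed.

Lemma abgroup_basis (s : seq 'I_(size la)) : uniq s ->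
  basis l [seq nth 0 la (val i) | i <- s] [seq abgroup_unit i | i <- s].
Proof.
elim: s => //= i s IH /andP[iNs us]; rewrite IH //= abgroup_unit_exp dvdnn /=.
(* The other generators lie in the kernel [K] of the i-th coordinate, but the relevant power of the
   i-th generator does not. *)
pose K : {set abgroup l la} := [set x : abgroup l la | x i == 1%g].
have gK : group_set K.
  apply/group_setP; split=> [|x y]; rewrite !inE ?oneg_ffun // => /eqP xi /eqP yi.
  by rewrite mulg_ffun xi yi mulg1.
suff sK : <<[set y in [seq abgroup_unit i | i <- s]]>> \subset Group gK.
  apply/negP=> /(subsetP sK); rewrite inE abgroup_expE => /eqP e1.
  have : abgroup_unit i ^+ (l ^ (nth 0 la i).-1)%N == 1.
    apply/eqP/ffunP=> j; case: (eqVneq i j) => [<-|ij].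
      by rewrite abgroup_expE e1 oneg_ffun.
    by rewrite abgroup_expE dfung1_dflt // expg1n oneg_ffun.
  rewrite abgroup_unit_exp dvdn_Pexp2l ?prime_gt1 //.
  by have := part_gt0 i; lia.
rewrite gen_subG; apply/subsetP=> y; rewrite !inE => /mapP[j js ->].
by rewrite dfung1_dflt //; apply: contraNneq iNs => <-.
Qed.

(** Reversed because [basis] lists the smallest orders first, while parts decrease. *)
Definition abgroup_units := [seq abgroup_unit i | i <- rev (enum 'I_(size la))].

Lemma abgroup_units_basis : basis l (rev la) abgroup_units.
Proof.
have -> : rev la = [seq nth 0 la (val i) | i <- rev (enum 'I_(size la))]%N.
  rewrite map_rev; congr rev.
  by rewrite (map_comp (nth 0%N la) val) val_enum_ord map_nth_iota0 ?take_size.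
by apply: abgroup_basis; rewrite rev_uniq enum_uniq.
Qed.

Lemma rev_parts_gt0 : all (leq 1) (rev la).
Proof. by rewrite all_rev; have /andP[] := partsP la. Qed.

Lemma abgroup_units_gen : <<[set y in abgroup_units]>> = [set: abgroup l la].
Proof.
apply/eqP; rewrite eqEcard subsetT /= card_abgroup.
rewrite (basis_card l_pr abgroup_abelian abgroup_pgroup rev_parts_gt0
  abgroup_units_basis).
by rewrite sumn_rev.
Qed.

Lemma abgroup_card_Ohm k :
  #|'Ohm_k([set: abgroup l la])| = (l ^ \sum_(j <- la) minn k j)%N.
Proof.
rewrite -abgroup_units_gen (basis_card_Ohm l_pr abgroup_abelian abgroup_pgroup k
  rev_parts_gt0 abgroup_units_basis).
by congr (_ ^ _)%N; apply: perm_big; rewrite perm_rev.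
Qed.

End abgroups.

Lemma num_subgroups_bases (l : nat) (la mu : intpart) : prime l ->
  nbases l (abgroup l la) (rev mu)
  = (num_subgroups l la mu * nbases l (abgroup l mu) (rev mu))%N.
Proof.
move=> l_pr.
by rewrite (@nbases_subgroups l _ _ _ _ l_pr (abgroup_abelian l mu)
  (abgroup_pgroup mu l_pr) (abgroup_abelian l la)
  (abgroup_pgroup la l_pr) (rev_parts_gt0 mu) (abgroup_units_basis mu l_pr)
  (abgroup_units_gen mu l_pr)).
Qed.

Local Open Scope ring_scope.

(** * Partitions built column by column *)

Section columns.
Local Open Scope nat_scope.
Implicit Types (la mu : intpart) (s : seq nat).

(** The number of boxes in the first k columns, counted row by row. *)
Definition colsum s k := \sum_(j <- s) minn k j.

Lemma intpart_gt0 la : all (leq 1) la.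
Proof. by have /andP[] := partsP la. Qed.

Lemma prankE la : prank la = size la.
Proof. by apply/eqP; rewrite -all_count intpart_gt0. Qed.

(** Puts a new first column of length a before the diagram: each row gains a box and rows of length
    one fill up the rest. This has the intended meaning when [size s <= a]. *)
Definition addcol_seq a s := map succn s ++ nseq (a - size s) 1.

Lemma addcol_subproof a la : is_partition (addcol_seq a la).
Proof.
have /andP[sla _] := partsP la; apply/andP; split; last first.
  rewrite all_cat all_nseq orbT andbT all_map.
  by apply/allP.
rewrite /addcol_seq (sorted_pairwise (leT := geq)); last by move=> ? ? ? /= ? ?; lia.
rewrite pairwise_cat; apply/and3P; split.
- apply/allrelP => x y /mapP[z _ ->]; rewrite mem_nseq => /andP[_ /eqP->].
  by rewrite /=; lia.
- rewrite pairwise_map; move: sla; rewrite (sorted_pairwise (leT := geq)) //.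
  by move=> ? ? ? /= ? ?; lia.
by elim: (a - _) => //= n ->; rewrite andbT all_nseq /= orbT.
Qed.

Definition addcol a la : intpart := IntPart (addcol_subproof a la).

Lemma rmcol_subproof la : is_partition [seq i.-1 | i <- la & 1 < i].
Proof.
have /andP[sla _] := partsP la; apply/andP; split; last first.
  rewrite all_map; apply/allP => i; rewrite mem_filter /= => /andP[i1 _].
  by lia.
move: sla; rewrite !(sorted_pairwise (leT := geq)); try by move=> ? ? ? /= ? ?; lia.
move=> sla; rewrite pairwise_map; apply: (pairwise_filter (fun i => 1 < i)) => //.
by apply: sub_pairwise sla => i j /=; lia.
Qed.

Definition rmcol la : intpart := IntPart (rmcol_subproof la).

Lemma size_addcol a la : size la <= a -> size (addcol a la) = a.
Proof. by move=> ?; rewrite /= size_cat size_map size_nseq; lia. Qed.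

Lemma addcolK a la : rmcol (addcol a la) = la.
Proof.
apply: val_inj => /=; rewrite filter_cat map_cat.
rewrite [filter _ (nseq _ _)](_ : _ = [::]) ?cats0; last by elim: (_ - _).
have := intpart_gt0 la; elim: (parts la) => //= i s IH /andP[i0 /IH].
by rewrite ltnS i0 /= => ->.
Qed.

Lemma rmcolK la : addcol (size la) (rmcol la) = la.
Proof.
apply: val_inj => /=; have /andP[] := partsP la; elim: (parts la) => //= i s IH.
move=> pis /andP[i0 s0]; have /IH/(_ s0) IHs := path_sorted pis.
rewrite /addcol_seq /=; case: ifP => i1 /=.
  by rewrite subSS prednK //; congr cons.
have {i1 i0 IHs IH} iE : i = 1 by lia.
move: pis; rewrite iE (path_sortedE (leT := geq)); last by move=> ? ? ? /= ? ?; lia.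
case/andP=> s1 _.
have {s1}sE : s = nseq (size s) 1.
  apply/all_pred1P; apply/allP=> j js; apply/eqP.
  by have := allP s1 j js; have := allP s0 j js; rewrite /=; lia.
rewrite sE; have -> n : [seq i <- nseq n 1 | 1 < i] = [::] by elim: n.
by rewrite /= size_nseq.
Qed.

Lemma size_rmcol la : size (rmcol la) <= size la.
Proof. by rewrite /= size_map size_filter count_size. Qed.

Lemma psize_addcol a la : size la <= a -> psize (addcol a la) = a + psize la.
Proof.
move=> le_a; rewrite /psize /= /addcol_seq sumn_cat sumn_nseq mul1n.
suff -> : sumn (map succn la) = size la + sumn la by lia.
by elim: (parts la) => //= i s ->; lia.
Qed.

(** Induction on the number of columns: removing the first column of a nonempty diagram lowers its
    size. *)
Lemma intpart_ind (P : intpart -> Prop) :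
    P empty_intpart ->
    (forall a la, 0 < a -> size la <= a -> P la -> P (addcol a la)) ->
  forall la, P la.
Proof.
move=> P0 PS la; have [n] := ubnP (psize la); elim: n la => // n IH la lan.
have [la0|la0] := posnP (size la).
  suff -> : la = empty_intpart by [].
  by apply: val_inj; apply/nilP/eqP.
rewrite -(rmcolK la); apply: PS => //; first exact: size_rmcol.
apply: IH; have := psize_addcol (size_rmcol la); rewrite rmcolK; lia.
Qed.

Lemma colsum_addcol a la k : size la <= a ->
  colsum (addcol a la) k.+1 = a + colsum la k.
Proof.
move=> le_a; rewrite /colsum big_cat /= big_map big_nseq iter_addn.
have -> : minn k.+1 1 = 1 by lia.
suff -> : \sum_(j <- la) minn k.+1 j.+1 = size la + \sum_(j <- la) minn k j by lia.
by elim: (parts la) => [|i s IH]; rewrite ?big_nil ?big_cons //= IH; lia.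
Qed.

Lemma colsum0 s : colsum s 0 = 0.
Proof. by rewrite /colsum big1 // => j _; rewrite min0n. Qed.

Lemma pcol_addcol1 a la : size la <= a -> pcol (addcol a la) 1 = a.
Proof. by move=> le_a; rewrite -[LHS]/(prank _) prankE size_addcol. Qed.

Lemma pcol_addcolS a la i : pcol (addcol a la) i.+2 = pcol la i.+1.
Proof.
rewrite /pcol /= count_cat count_map count_nseq /= mul0n addn0.
by apply: eq_count.
Qed.

Lemma pmult_addcol1 a la : pmult (addcol a la) 1 = a - size la.
Proof.
rewrite /pmult /= count_cat count_map count_nseq /= mul1n.
rewrite [count _ _](_ : _ = 0) //; apply/eqP; rewrite eqn0Ngt -has_count.
apply/hasPn => i ila; have := allP (intpart_gt0 la) i ila; rewrite /=; lia.
Qed.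

Lemma pmult_addcolS a la i : pmult (addcol a la) i.+2 = pmult la i.+1.
Proof.
rewrite /pmult /= count_cat count_map count_nseq /= mul0n addn0.
by apply: eq_count => j.
Qed.

Lemma rev_addcol a la :
  rev (addcol a la) = nseq (a - size la) 1 ++ map succn (rev la).
Proof. by rewrite /= rev_cat rev_nseq map_rev. Qed.

Lemma pcol_gt la i : psize la < i -> pcol la i = 0.
Proof.
move=> lai; apply/eqP; rewrite eqn0Ngt -has_count; apply/hasPn=> j jla.
by rewrite -ltnNge (leq_ltn_trans _ lai) // /psize sumnE (big_rem j) //= leq_addr.
Qed.

Lemma pmult_gt la i : psize la < i -> pmult la i = 0.
Proof.
move=> lai; apply/eqP; rewrite eqn0Ngt -has_count; apply/hasPn=> j jla /=.
apply/eqP=> ji; move: lai; rewrite -ji /psize sumnE (big_rem j) //=; lia.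
Qed.

End columns.

(** * Gaussian binomials *)

Section gaussian_binomial.

(** The Gaussian binomial, given by Pascal's rule so that it needs no division and can be evaluated
    at the indeterminate ['X]. *)
Fixpoint qbin (K : pzSemiRingType) (x : K) (n k : nat) : K :=
  match n, k with
  | _, 0 => 1
  | 0, _.+1 => 0
  | n'.+1, k'.+1 => qbin x n' k' + x ^+ k'.+1 * qbin x n' k'.+1
  end.

Lemma qbin_small (K : pzSemiRingType) (x : K) n k : (n < k)%N -> qbin x n k = 0.
Proof.
elim: n k => [|n IH] [|k] //= nk.
by rewrite !IH ?mulr0 ?addr0 //; lia.
Qed.

Lemma qbin_prod (K : comPzRingType) (x : K) n k :
  qbin x n k * \prod_(j < k) (x ^+ k - x ^+ j) = \prod_(j < k) (x ^+ n - x ^+ j).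
Proof.
(* Two recursions for [g] drive the proof: [gSS] splits off the first factor and lowers both
   indices, [gS] splits off the last. *)
pose g a b : K := \prod_(j < b) (x ^+ a - x ^+ j).
have gSS a b : g a.+1 b.+1 = (x ^+ a.+1 - 1) * x ^+ b * g a b.
  rewrite /g big_ord_recl expr0 -mulrA; congr (_ * _).
  rewrite -[in x ^+ b](card_ord b) -prodr_const -big_split /=.
  by apply: eq_bigr => j _; rewrite mulrBr -!exprS.
have gS a b : g a b.+1 = g a b * (x ^+ a - x ^+ b) by rewrite /g big_ord_recr.
rewrite -/(g k k) -/(g n k); elim: n k => [|n IH] [|k] /=.
- by rewrite mul1r.
- by rewrite mul0r /g big_ord_recl subrr mul0r.
- by rewrite mul1r /g !big_ord0.
rewrite mulrDl -mulrA IH gSS [_ * g k k]mulrC !mulrA IH [in RHS]gSS gS !exprS.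
by ring.
Qed.

Lemma horner_qbinX (K : comNzRingType) (x : K) n k : (qbin 'X n k).[x] = qbin x n k.
Proof.
elim: n k => [|n IH] [|k] /=; rewrite ?hornerC //.
by rewrite hornerD hornerM hornerXn !IH.
Qed.

End gaussian_binomial.

(** * The product formula for injections *)

Section injections.

(* [inj_count l la (rev mu)] counts the injections of a group of type mu into a
   group of type la; [l ^ colsum la k] is the order of its l^k-torsion. *)
Fixpoint inj_count (K : pzRingType) (x : K) (la s : seq nat) : K :=
  if s is m :: s' then
    (x ^+ colsum la m - x ^+ (colsum la m.-1 + size s')) * inj_count x la s'
  else 1.

Lemma nbases_inj_count (K : pzRingType) (l : nat) (la : intpart) (s : seq nat) :
    prime l -> sorted leq s -> all (leq 1) s ->
  (nbases l (abgroup l la) s)%:R = inj_count (l%:R : K) la s.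
Proof.
move=> l_pr; elim: s => [|m s IH] /=.
  move=> _ _; rewrite /nbases [X in X%:R](_ : _ = 1%N) //.
  transitivity #|{: 0.-tuple (abgroup l la)}|; last by rewrite card_tuple.
  by apply: eq_card => t; rewrite tuple0 inE.
rewrite path_sortedE; last exact: leq_trans.
move=> /andP[ms /IH{}IH] /andP[m0 /IH{}IH].
have [c [-> cE]] :=
  nbases_cons l_pr (abgroup_abelian l la) (abgroup_pgroup la l_pr) m0 ms.
(* Without a basis of type [s] both sides vanish, whatever [c] is. *)
rewrite natrM IH; have [n0|/cE{}cE] := posnP (nbases l (abgroup l la) s).
  by rewrite -IH n0 !mulr0.
congr (_ * _); move: cE; rewrite !abgroup_card_Ohm // -expnD addnC => cE.
apply/eqP; rewrite eq_sym subr_eq -!natrX -natrD addnC.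
by rewrite [(colsum _ _ + size s)%N]addnC cE.
Qed.

Variables (K : comPzRingType) (x : K).
Implicit Types (la mu : intpart).

(** A new column of length a multiplies both powers in every factor by [x ^+ a]. *)
Lemma inj_count_succ a la s : (size la <= a)%N -> all (leq 1) s ->
  inj_count x (addcol a la) (map succn s) = x ^+ (a * size s) * inj_count x la s.
Proof.
move=> le_a; elim: s => [|m s IH] /=; first by rewrite muln0 expr0 mulr1.
case/andP=> m0 /IH ->; rewrite size_map colsum_addcol //.
rewrite -[in colsum (addcol_seq a la) m](prednK m0).
rewrite -[addcol_seq a la]/(parts (addcol a la)) colsum_addcol //.
by rewrite mulnS !exprD; ring.
Qed.

Lemma inj_count_ones a la s k : (size la <= a)%N ->
  inj_count x (addcol a la) (nseq k 1%N ++ s) =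
  (\prod_(i < k) (x ^+ a - x ^+ (size s + i))) * inj_count x (addcol a la) s.
Proof.
move=> le_a; elim: k => [|k IH]; first by rewrite big_ord0 mul1r.
rewrite big_ord_recr /= -/(parts (addcol a la)) IH colsum_addcol //.
rewrite !colsum0 !addn0 add0n.
by rewrite size_cat size_nseq addnC; ring.
Qed.

(** The b - size mu rows of length one contribute the product, and each longer row contributes
    [x ^+ a]. *)
Lemma inj_count_addcol a b la mu : (size la <= a)%N -> (size mu <= b)%N ->
  inj_count x (addcol a la) (rev (addcol b mu)) =
  x ^+ (a * size mu) * \prod_(i < b - size mu) (x ^+ a - x ^+ (size mu + i))
  * inj_count x la (rev mu).
Proof.
move=> le_a le_b; rewrite rev_addcol inj_count_ones // inj_count_succ ?rev_parts_gt0 //.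
by rewrite size_map size_rev mulrCA mulrA.
Qed.

Lemma inj_count_eq0 la mu : (size la < size mu)%N -> inj_count x la (rev mu) = 0.
Proof.
elim/intpart_ind: mu la => [|b mu b0 le_b IH] la; first by rewrite ltn0.
rewrite size_addcol // => lab; rewrite -(rmcolK la) inj_count_addcol ?size_rmcol //.
have [mula|lamu] := leqP (size mu) (size la); last first.
  by rewrite IH ?mulr0 // (leq_ltn_trans (size_rmcol _)).
(* At this index the factor is [x ^+ size la - x ^+ size la]. *)
have lti : (size la - size mu < b - size mu)%N by lia.
by rewrite (bigD1 (Ordinal lti)) //= subnKC // subrr !(mul0r, mulr0).
Qed.

End injections.

(** * Existence of Hall's polynomial *)

Section hall_polynomial.
Variable R : comNzRingType.

Lemma hall_poly_exists (la mu : intpart) : exists P : {poly R}, forall x,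
  P.[x] * inj_count x mu (rev mu) = inj_count x la (rev mu).
Proof.
elim/intpart_ind: mu la => [|b mu b0 le_b IH] la.
  by exists 1 => x; rewrite hornerC mul1r.
have [lab|bla] := ltnP (size la) b.
  by exists 0 => x; rewrite horner0 mul0r inj_count_eq0 // size_addcol.
have [P PE] := IH (rmcol la); pose c := size mu.
(* The quotient of the two first-column factors: once [x ^+ c] is taken out of each difference, the
   products have a Gaussian binomial as quotient, and a power of [x] remains. *)
exists (P * 'X^((size la - b) * c) * qbin 'X (size la - c) (b - c)) => x.
rewrite -[in RHS](rmcolK la) !inj_count_addcol ?size_rmcol // -PE -/c.
have prodE a : (c <= a)%N -> \prod_(i < b - c) (x ^+ a - x ^+ (c + i)) =
    x ^+ (c * (b - c)) * \prod_(i < b - c) (x ^+ (a - c) - x ^+ i).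
  move=> ca; have -> : x ^+ (c * (b - c)) = \prod_(i < b - c) x ^+ c.
    by rewrite prodr_const card_ord exprM.
  rewrite -big_split /=.
  by apply: eq_bigr => i _; rewrite mulrBr -!exprD subnKC.
rewrite !prodE ?(leq_trans le_b) // -(qbin_prod x (size la - c)).
rewrite !hornerM hornerXn horner_qbinX.
have -> : (size la * c = (size la - b) * c + b * c)%N by rewrite -mulnDl subnK.
by rewrite exprD; ring.
Qed.

End hall_polynomial.

(** * Signs of the product formula for p > 1 *)

Section positivity.
Variables (R : realFieldType) (p : R).
Hypothesis hp : 1 < p.
Implicit Types (la mu : intpart).

Let p0 : 0 < p. Proof. exact: lt_trans hp. Qed.

Lemma colprod_gt0 a c k : (c + k <= a)%N ->
  0 < \prod_(i < k) (p ^+ a - p ^+ (c + i)).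
Proof.
move=> le_a; apply: prodr_gt0 => i _; rewrite subr_gt0 ltr_eXn2l //.
by have := ltn_ord i; lia.
Qed.

Lemma inj_count_self_gt0 mu : 0 < inj_count p mu (rev mu).
Proof.
elim/intpart_ind: mu => [|b mu b0 le_b IH]; first exact: ltr01.
rewrite inj_count_addcol // !mulr_gt0 ?exprn_gt0 ?colprod_gt0 //; lia.
Qed.

Lemma inj_count_ge0 la mu : 0 <= inj_count p la (rev mu).
Proof.
elim/intpart_ind: mu la => [|b mu b0 le_b IH] la; first exact: ler01.
have [lab|bla] := ltnP (size la) b.
  by rewrite inj_count_eq0 // size_addcol.
rewrite -(rmcolK la) inj_count_addcol ?size_rmcol //.
by rewrite !mulr_ge0 ?exprn_ge0 ?(ltW p0) ?(ltW (colprod_gt0 _)) //; lia.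
Qed.

End positivity.

(* Imported only here because it shadows names of finset and seq. *)
From mathcomp Require Import all_classical all_reals all_analysis.

Local Open Scope classical_set_scope.

(** * Passing from primes to real arguments *)

Section counting_at_primes.
Variable R : realType.
Implicit Types (la mu : intpart).

Lemma primes_unbounded n : exists s : seq nat, [/\ uniq s, all prime s & size s = n].
Proof.
elim: n => [|n [s [us ps <-]]]; first by exists [::].
have [q qs q_pr] := prime_above (\max_(i <- s) i).
exists (q :: s); rewrite /= us q_pr ps andbT; split=> //; apply/negP=> qin.
by move: qs; rewrite ltnNge (leq_bigmax_seq (F := id)).
Qed.

Lemma eq_poly_primes (P Q : {poly R}) :
  (forall l, prime l -> P.[l%:R] = Q.[l%:R]) -> P = Q.
Proof.
move=> PQ; apply/eqP; rewrite -subr_eq0; apply/eqP.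
have [s [us ps sz]] := primes_unbounded (size (P - Q)).
apply: (@roots_geq_poly_eq0 _ _ [seq l%:R | l <- s]).
- rewrite all_map; apply/allP => l /(allP ps) /= l_pr.
  by rewrite rootE !hornerE PQ // subrr.
- by rewrite map_inj_uniq // => i j /eqP; rewrite eqr_nat => /eqP.
by rewrite size_map sz.
Qed.

Lemma sorted_rev_parts la : sorted leq (rev la).
Proof. by rewrite rev_sorted; have /andP[] := partsP la. Qed.

Lemma num_subgroups_inj_count l la mu : prime l ->
  (num_subgroups l la mu)%:R * inj_count (l%:R : R) mu (rev mu)
  = inj_count (l%:R : R) la (rev mu).
Proof.
move=> l_pr; rewrite -!nbases_inj_count ?sorted_rev_parts ?rev_parts_gt0 //.
by rewrite (num_subgroups_bases la mu l_pr) natrM.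
Qed.

(** The quotient polynomial [P] meets the specification at all primes. The polynomial selected by
    [xget] therefore meets it too, and the two agree at infinitely many points. *)
Lemma subgroup_poly_inj_count la mu (x : R) :
  (subgroup_poly R la mu).[x] * inj_count x mu (rev mu) = inj_count x la (rev mu).
Proof.
have [P PE] := hall_poly_exists R la mu.
have Pspec : subgroup_poly_spec la mu P.
  move=> l l_pr; have l1 : 1 < l%:R :> R by rewrite ltr1n prime_gt1.
  apply: (mulIf (lt0r_neq0 (inj_count_self_gt0 l1 mu))).
  by rewrite PE num_subgroups_inj_count.
have := xgetI 0 Pspec; rewrite -/(subgroup_poly R la mu) => spec.
rewrite (@eq_poly_primes (subgroup_poly R la mu) P) // => l l_pr.
by rewrite spec ?Pspec.
Qed.

End counting_at_primes.

(** * Finite q-series identities in base 1/p *)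

Section pochhammer.
Variables (R : realType) (p : R).
Hypothesis hp : 1 < p.
Let p0 : 0 < p. Proof. exact: lt_trans hp. Qed.
Let pn0 : p != 0. Proof. exact: lt0r_neq0. Qed.

Lemma pochS (y : R) n : poch p (y / p) n.+1 = poch p (y / p) n * (1 - y / p ^+ n.+1).
Proof. by rewrite /poch big_nat_recr //= exprS invfM mulrA. Qed.

Lemma poch0 (y : R) : poch p y 0 = 1.
Proof. by rewrite /poch big_geq. Qed.

Lemma poch_gt0 (y : R) n : y < p -> 0 < poch p (y / p) n.
Proof.
move=> yp; elim: n => [|n IH]; first by rewrite poch0.
rewrite pochS mulr_gt0 // subr_gt0 ltr_pdivrMr ?exprn_gt0 // mul1r.
by apply: (lt_le_trans yp); rewrite -[leLHS]expr1 ler_eXn2l.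
Qed.

Lemma poch1_gt0 n : 0 < poch p (1 / p) n.
Proof. exact: poch_gt0. Qed.

Lemma poch1_neq0 n : poch p (1 / p) n != 0.
Proof. exact: lt0r_neq0 (poch1_gt0 n). Qed.

(** Each difference is [p ^+ a] times 1 - 1/p^(a-c-i), and these are the last k factors of
    [poch p (1 / p) (a - c)]. *)
Lemma colprod_poch a c k : (c + k <= a)%N ->
  (\prod_(i < k) (p ^+ a - p ^+ (c + i))) * poch p (1 / p) (a - (c + k))
  = p ^+ (a * k) * poch p (1 / p) (a - c).
Proof.
elim: k => [|k IH] le_a; first by rewrite big_ord0 muln0 addn0.
have -> : p ^+ (a * k.+1) = p ^+ a * p ^+ (a * k) by rewrite mulnS exprD.
rewrite big_ord_recr /= -[RHS]mulrA -IH; last by lia.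
have -> : (a - (c + k) = (a - (c + k.+1)).+1)%N by lia.
rewrite pochS; set e := (a - (c + k.+1))%N.
have -> : p ^+ a - p ^+ (c + k) = p ^+ a * (1 - 1 / p ^+ e.+1).
  rewrite mulrBr mulr1; congr (_ - _).
  have -> : p ^+ a = p ^+ (c + k) * p ^+ e.+1.
    by rewrite -exprD; congr (_ ^+ _); rewrite /e; lia.
  by rewrite div1r mulfK // expf_neq0.
by ring.
Qed.

(** By Pascal's rule this comes down to (1 - p^-(k+1)) + p^-(k+1) (1 - p^-(n-k)) = 1 - p^-(n+1). *)
Lemma qbin_poch n k : (k <= n)%N ->
  qbin p^-1 n k * poch p (1 / p) k * poch p (1 / p) (n - k) = poch p (1 / p) n.
Proof.
elim: n k => [|n IH] [|k] //=.
- by rewrite !poch0 !mulr1.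
- by rewrite poch0 mulr1 subn0 [LHS]mul1r.
rewrite ltnS leq_eqVlt => /orP[/eqP->|kn].
  rewrite subnn poch0 mulr1 (@qbin_small _ _ n n.+1) // mulr0 addr0 !pochS mulrA.
  by have := IH n (leqnn n); rewrite subnn poch0 mulr1 => ->.
have IHk := IH k (ltnW kn); have IHk1 := IH _ kn.
rewrite subSS; have nkE : (n - k = (n - k.+1).+1)%N by lia.
transitivity ((qbin p^-1 n k * poch p (1 / p) k * poch p (1 / p) (n - k))
    * (1 - 1 / p ^+ k.+1)
  + p^-1 ^+ k.+1 * (qbin p^-1 n k.+1 * poch p (1 / p) k.+1
    * poch p (1 / p) (n - k.+1)) * (1 - 1 / p ^+ (n - k))).
  by rewrite nkE !pochS; ring.
rewrite IHk IHk1 pochS.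
have -> : p ^+ n.+1 = p ^+ k.+1 * p ^+ (n - k) by rewrite -exprD; congr (_ ^+ _); lia.
rewrite exprVn; field.
by rewrite !expf_neq0.
Qed.

Variable u : R.
Hypothesis hup : u < p.

Let uq_neq0 n : poch p (u / p) n != 0.
Proof. exact: lt0r_neq0 (poch_gt0 n hup). Qed.

(* Pascal's rule [n+1;k] = t^k [n;k] + [n;k-1] turns the sum for (n+1, b) into
   the sum for (n, b+1). *)
Lemma durfee_identity n b :
  \sum_(k < n.+1) qbin p^-1 n k * u ^+ k * p^-1 ^+ (k * (b + k))
     / poch p (u / p) (b + k) = (poch p (u / p) (b + n))^-1.
Proof.
pose w b k := u ^+ k * p^-1 ^+ (k * (b + k)) / poch p (u / p) (b + k).
suff H : forall n b, \sum_(k < n.+1) qbin p^-1 n k * w b k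
    = (poch p (u / p) (b + n))^-1.
  by rewrite -H; apply: eq_bigr => k _; rewrite /w !mulrA.
move=> {n b}; elim=> [|n IH] b.
  by rewrite big_ord_recl big_ord0 addr0 /w /= mul0n !expr0 !mul1r.
have wS k : p^-1 ^+ k * w b k + w b k.+1 = w b.+1 k.
  have := uq_neq0 (b + k).+1; rewrite /w.
  have -> : (k.+1 * (b + k.+1) = (k * (b + k) + k) + (b + k).+1)%N by lia.
  have -> : (k * (b.+1 + k) = k * (b + k) + k)%N by lia.
  have -> : (b + k.+1 = (b + k).+1)%N by lia.
  have -> : (b.+1 + k = (b + k).+1)%N by lia.
  rewrite (exprS u) (exprD _ (_ + k)%N) (exprD _ _ k) pochS [u / _]mulrC -exprVn.
  rewrite mulf_eq0 negb_or => /andP[h1 h2].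
  field; rewrite h1 !andbT.
  by rewrite mulrC addrC; move: h2; rewrite mulrC addrC.
rewrite addnS -addSn -IH.
transitivity (\sum_(k < n.+1) qbin p^-1 n k * (p^-1 ^+ k * w b k + w b k.+1));
  last by apply: eq_bigr => k _; rewrite wS.
under [RHS]eq_bigr => k _ do rewrite mulrDr.
rewrite big_split /=.
have -> : \sum_(k < n.+1) qbin p^-1 n k * (p^-1 ^+ k * w b k) =
    w b 0 + \sum_(k < n.+1) p^-1 ^+ k.+1 * qbin p^-1 n k.+1 * w b k.+1.
  transitivity (\sum_(k < n.+2) qbin p^-1 n k * (p^-1 ^+ k * w b k)).
    by rewrite [RHS]big_ord_recr /= qbin_small // mul0r addr0.
  rewrite big_ord_recl /=; congr (_ + _).
    by case: (n) => [|?]; rewrite /= expr0 !mul1r.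
  by apply: eq_bigr => k _; rewrite /bump /= add1n mulrA [qbin _ _ _ * _]mulrC.
rewrite big_ord_recl /= mul1r -addrA; congr (_ + _).
rewrite -big_split /=; apply: eq_bigr => k _.
by rewrite /bump /= add1n mulrDl addrC.
Qed.

(** The terms with a < b vanish, and the shift a = k + b turns the others into [durfee_identity] for
    n = a0 - b. *)
Lemma column_identity a0 b c : (c <= b <= a0)%N ->
  \sum_(a < a0.+1)
     u ^+ a * p ^+ (a * c) * (\prod_(i < b - c) (p ^+ a - p ^+ (c + i)))
     / (p ^+ (a ^ 2) * poch p (1 / p) (a0 - a))
     * (if (c <= a)%N then (poch p (1 / p) (a - c) * poch p (u / p) a)^-1 else 0)
  = u ^+ b / (poch p (1 / p) (a0 - b) * poch p (u / p) a0).
Proof.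
case/andP=> cb ba.
have [pn pu] := (poch1_neq0, uq_neq0).
pose F (a : nat) :=
     u ^+ a * p ^+ (a * c) * (\prod_(i < b - c) (p ^+ a - p ^+ (c + i)))
     / (p ^+ (a ^ 2) * poch p (1 / p) (a0 - a))
     * (if (c <= a)%N then (poch p (1 / p) (a - c) * poch p (u / p) a)^-1 else 0).
rewrite -[LHS](big_mkord xpredT F) (big_cat_nat (n := b)) //=; last by lia.
rewrite big_nat big1 ?add0r; last first.
  move=> a /andP[_ ab]; rewrite /F; case: ifP => ca; last by rewrite mulr0.
  have lti : (a - c < b - c)%N by lia.
  by rewrite (bigD1 (Ordinal lti)) //= subnKC // subrr !(mul0r, mulr0).
rewrite -{1}[b]add0n big_addn subSn //.
have FE k : (k < (a0 - b).+1)%N -> F (k + b)%N =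
    u ^+ b / poch p (1 / p) (a0 - b) *
    (qbin p^-1 (a0 - b) k * u ^+ k * p^-1 ^+ (k * (b + k))
       / poch p (u / p) (b + k)).
  move=> kn; rewrite /F ifT; last by lia.
  have := @colprod_poch (k + b) c (b - c).
  have -> : (c + (b - c) = b)%N by lia.
  rewrite addnK => /(_ (leq_addl _ _)) cE.
  have {cE}-> : \prod_(i < b - c) (p ^+ (k + b) - p ^+ (c + i)) =
      p ^+ ((k + b) * (b - c)) * poch p (1 / p) (k + b - c) / poch p (1 / p) k.
    by rewrite -cE mulfK.
  have := @qbin_poch (a0 - b) k; rewrite -ltnS => /(_ kn) qE.
  have {qE}-> : qbin p^-1 (a0 - b) k =
      poch p (1 / p) (a0 - b) / (poch p (1 / p) k * poch p (1 / p) (a0 - b - k)).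
    by rewrite -qE -mulrA mulfK // mulf_neq0.
  rewrite (addnC k b) subnDA.
  have -> : ((b + k) ^ 2 = (b + k) * c + (b + k) * (b - c) + k * (b + k))%N.
    by rewrite -mulnDr subnKC // -mulnn; lia.
  rewrite exprVn !exprD; field.
  by rewrite !pn !pu !expf_neq0.
rewrite big_nat (eq_bigr _ (fun k hk => FE k hk)) -big_nat big_mkord.
rewrite -mulr_sumr durfee_identity subnKC // invfM mulrA //.
Qed.

End pochhammer.

(** * Automorphisms and surjections through the product formula *)

Section automorphisms.
Variables (R : realType) (p : R).
Hypothesis hp : 1 < p.
Implicit Types (la mu : intpart).

Lemma card_aut_bound la N : (psize la <= N)%N ->
  card_aut p la = p ^+ (\sum_(1 <= i < N.+1) pcol la i ^ 2)%N
    * \prod_(1 <= i < N.+1) poch p (1 / p) (pmult la i).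
Proof.
move=> le_N; rewrite /card_aut; congr (p ^+ _ * _).
  rewrite [RHS](big_cat_nat (n := (psize la).+1)) //= [X in (_ + X)%N]big_nat.
  by rewrite [X in (_ + X)%N]big1 ?addn0 // => i /andP[h _]; rewrite pcol_gt.
rewrite [RHS](big_cat_nat (n := (psize la).+1)) //= -[LHS]mulr1; congr (_ * _).
by rewrite big_nat big1 // => i /andP[h _]; rewrite pmult_gt // poch0.
Qed.

Lemma card_aut_addcol a la : (size la <= a)%N ->
  card_aut p (addcol a la) =
  p ^+ (a ^ 2) * poch p (1 / p) (a - size la) * card_aut p la.
Proof.
(* For a = 0 the cut-off [(psize la + a).-1] used for [la] below could be too small. *)
move=> le_a; have [a0|a0] := posnP a.
  move: le_a; rewrite a0 leqn0 => /nilP la0; rewrite la0 expr0 poch0 !mul1r.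
  by congr (card_aut p _); apply: val_inj => /=; rewrite /addcol_seq la0.
rewrite (@card_aut_bound (addcol a la) (psize la + a)); last first.
  by rewrite psize_addcol // addnC.
rewrite (@card_aut_bound la (psize la + a).-1); last by lia.
rewrite (prednK (_ : 0 < psize la + a)%N); last by lia.
have -> : (\sum_(1 <= i < (psize la + a).+1) pcol (addcol a la) i ^ 2
    = a ^ 2 + \sum_(1 <= i < psize la + a) pcol la i ^ 2)%N.
  rewrite big_ltn ?pcol_addcol1 //; last by lia.
  congr addn; rewrite big_add1.
  by apply: eq_big_nat => -[] // i _; rewrite pcol_addcolS.
have -> : \prod_(1 <= i < (psize la + a).+1) poch p (1 / p) (pmult (addcol a la) i)
    = poch p (1 / p) (a - size la)
      * \prod_(1 <= i < psize la + a) poch p (1 / p) (pmult la i).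
  rewrite big_ltn ?pmult_addcol1 //; last by lia.
  congr (_ * _); rewrite big_add1.
  by apply: eq_big_nat => -[] // i _; rewrite pmult_addcolS.
by rewrite exprD; ring.
Qed.

Lemma card_aut_inj_count mu : card_aut p mu = inj_count p mu (rev mu).
Proof.
elim/intpart_ind: mu => [|b mu b0 le_b IH].
  by rewrite /card_aut /psize /= !big_geq // expr0 mul1r.
rewrite card_aut_addcol // inj_count_addcol // IH; congr (_ * _).
have := @colprod_poch R p hp b (size mu) (b - size mu).
rewrite subnKC // leqnn => /(_ isT); rewrite subnn poch0 mulr1 => ->.
by rewrite mulrA -exprD -mulnDr subnKC // mulnn.
Qed.

(** [card_aut p mu] is exactly the denominator of Hall's polynomial, so it cancels. *)
Lemma card_sur_inj_count la mu : card_sur p la mu = inj_count p la (rev mu).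
Proof. by rewrite /card_sur card_aut_inj_count subgroup_poly_inj_count. Qed.

Lemma card_aut_gt0 mu : 0 < card_aut p mu.
Proof. by rewrite card_aut_inj_count inj_count_self_gt0. Qed.

Lemma card_sur_ge0 la mu : 0 <= card_sur p la mu.
Proof. by rewrite card_sur_inj_count inj_count_ge0. Qed.

Lemma card_sur_self mu : card_sur p mu mu = card_aut p mu.
Proof. by rewrite card_sur_inj_count card_aut_inj_count. Qed.

End automorphisms.

(** * Sums over partitions *)

Section esum_extra.
Variable R : realType.

Lemma esumZl (T : choiceType) (I : set T) (c : R) (f : T -> R) :
  0 <= c -> (forall i, 0 <= f i) ->
  \esum_(i in I) (c * f i)%:E = (c%:E * \esum_(i in I) (f i)%:E)%E.
Proof.
move=> c0 f0; rewrite /esum -ereal_supZl //; last first.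
  by apply/set0P; exists 0%E; exists set0; [exact: fsets_set0|rewrite fsbig_set0].
congr ereal_sup; rewrite image_comp; apply: eq_imagel => X _ /=.
by rewrite ge0_mule_fsumr // => i; rewrite lee_fin.
Qed.

(** Partitions are sorted by the length a of the first column; what remains after removing it is any
    partition with at most a rows. *)
Lemma esum_columns a0 (f : intpart -> \bar R) : (forall la, 0 <= f la)%E ->
  \esum_(la in [set la : intpart | (size la <= a0)%N]) f la =
  (\sum_(a < a0.+1)
     \esum_(la in [set la : intpart | (size la <= a)%N]) f (addcol a la))%E.
Proof.
move=> f0.
transitivity (\esum_(la in [set la : intpart | (size la <= a0)%N])
    (\sum_(a < a0.+1) (if la \in [set la : intpart | size la = a :> nat]
                       then f la else 0))%E).
  apply: eq_esum => la /=; rewrite -ltnS => le_a.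
  rewrite (bigD1 (Ordinal le_a)) //= mem_set // big1 ?adde0 // => a ne_a.
  by rewrite memNset //= => sa; case/eqP: ne_a; apply: val_inj.
rewrite esum_sum; last by move=> la a _ _; case: ifP.
apply: eq_bigr => a _; rewrite -esum_mkcondr.
apply: reindex_esum; split=> /=.
- by move=> la /= le_a; rewrite size_addcol // -ltnS ltn_ord.
- move=> la la' _ _ /(congr1 rmcol); by rewrite !addcolK.
- move=> la [/= _ la_a]; exists (rmcol la); rewrite /= -?la_a ?rmcolK //.
  exact: size_rmcol.
Qed.

End esum_extra.

(** * Weighted sums computed column by column *)

Section column_sums.
Variables (R : realType) (p u : R).
Hypotheses (hp : 1 < p) (hu0 : 0 < u) (hup : u < p).
Implicit Types (la mu : intpart).
Let p0 : 0 < p. Proof. exact: lt_trans hp. Qed.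

(* At a = d this is [Pdu p u d la * card_sur p la mu], up to the constant
   [poch p (u / p) d * poch p (1 / p) d]; letting a vary makes the sum over la
   satisfy a recursion on the number of columns. *)
Definition sur_weight a mu la : R :=
  u ^+ psize la * inj_count p la (rev mu)
  / (card_aut p la * poch p (1 / p) (a - size la)).

(** The ratio of weights when first columns of lengths a and b are added to la and mu; c stands for
    the length of mu. *)
Definition col_factor a0 a b c : R :=
  u ^+ a * p ^+ (a * c) * (\prod_(i < b - c) (p ^+ a - p ^+ (c + i)))
  / (p ^+ (a ^ 2) * poch p (1 / p) (a0 - a)).

Lemma sur_weight_ge0 a mu la : 0 <= sur_weight a mu la.
Proof.
rewrite divr_ge0 // mulr_ge0 ?exprn_ge0 ?inj_count_ge0 ?(ltW hu0) //.
  exact: ltW (card_aut_gt0 hp la).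
exact: ltW (poch1_gt0 hp _).
Qed.

Lemma sur_weight_addcol a0 a b mu la : (size la <= a)%N -> (size mu <= b)%N ->
  sur_weight a0 (addcol b mu) (addcol a la) =
  col_factor a0 a b (size mu) * sur_weight a mu la.
Proof.
move=> le_a le_b; rewrite /sur_weight /col_factor size_addcol // psize_addcol //.
rewrite inj_count_addcol // card_aut_addcol // exprD; field.
by rewrite !poch1_neq0 // !expf_neq0 ?lt0r_neq0 // ?card_aut_gt0.
Qed.

Lemma sur_weight_eq0 a mu la : (size la < size mu)%N -> sur_weight a mu la = 0.
Proof. by move=> lt; rewrite /sur_weight inj_count_eq0 // mulr0 mul0r. Qed.

Lemma col_factor_ge0 a0 a b c : (c <= a)%N -> (c <= b)%N -> 0 <= col_factor a0 a b c.
Proof.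
move=> ca cb; rewrite divr_ge0 //; last first.
  by rewrite mulr_ge0 ?exprn_ge0 ?(ltW p0) // ltW // poch1_gt0.
rewrite !mulr_ge0 ?exprn_ge0 ?(ltW p0) ?(ltW hu0) //.
have [ba|ab] := leqP b a; first by rewrite ltW // colprod_gt0 // subnKC.
have lti : (a - c < b - c)%N by lia.
by rewrite (bigD1 (Ordinal lti)) //= subnKC // subrr mul0r.
Qed.

Lemma addcol0 : addcol 0 empty_intpart = empty_intpart.
Proof. exact: val_inj. Qed.

Local Notation V a := (poch p (1 / p) a * poch p (u / p) a)^-1.

Lemma col_factor_fixpoint a0 : \sum_(a < a0.+1) col_factor a0 a 0 0 * V a = V a0.
Proof.
have := @column_identity R p hp u hup a0 0 0 isT.
rewrite (subn0 a0) expr0 => cE; rewrite -[RHS]mul1r -cE.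
by apply: eq_bigr => a _; rewrite /col_factor /= !subn0.
Qed.

Lemma poch_le1 a : poch p (u / p) a <= 1.
Proof.
elim: a => [|a IH]; first by rewrite poch0.
rewrite pochS mulr_ile1 ?(ltW (poch_gt0 hp _ hup)) //.
  rewrite subr_ge0 ler_pdivrMr ?exprn_gt0 // mul1r.
  by apply: (le_trans (ltW hup)); rewrite -[leLHS]expr1 ler_eXn2l.
by rewrite gerBl divr_ge0 ?exprn_ge0 ?ltW.
Qed.

Lemma sur_weight0 a : sur_weight a empty_intpart empty_intpart = (poch p (1 / p) a)^-1.
Proof.
rewrite /sur_weight /= subn0 /card_aut /psize /= !big_geq //.
by rewrite !expr0 !mul1r.
Qed.

(** Keeps the partitions with at most N columns, so that the total can be bounded by induction on N
    before its finiteness is known. *)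
Definition bounded_weight N a la : R :=
  if all (leq^~ N) la then sur_weight a empty_intpart la else 0.

(** For N = 0 only the empty partition counts and [poch_le1] gives the bound; each further column
    preserves it because [V] is a fixed point of the recursion. *)
Lemma bounded_weight_le N a :
  (\esum_(la in [set la : intpart | (size la <= a)%N]) (bounded_weight N a la)%:E
   <= (V a)%:E)%E.
Proof.
elim: N a => [|N IH] a0.
  rewrite (_ : \esum_(la in _) _ =
    \esum_(la in [set empty_intpart]) (sur_weight a0 empty_intpart la)%:E).
    rewrite esum_set1 ?lee_fin ?sur_weight_ge0 // sur_weight0.
    by rewrite lef_pV2 ?posrE ?mulr_gt0 ?poch_gt0 // ler_piMr ?poch_le1 ?ltW ?poch_gt0.
  rewrite esum_mkcond [RHS]esum_mkcond; apply: eq_esum => la _.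
  rewrite /bounded_weight; have [la0|la0] := eqVneq la empty_intpart.
    by rewrite la0 !mem_set.
  rewrite [in RHS]memNset; last by move=> /= h; rewrite h eqxx in la0.
  rewrite [if all _ _ then _ else _](_ : _ = 0) ?if_same // ifF //.
  apply/negP => lal; case/eqP: la0; apply: val_inj => /=.
  have := intpart_gt0 la; move: lal; case: (parts la) => //= i s.
  by case/andP=> i0 _ /andP[]; rewrite ltnNge i0.
rewrite esum_columns; last first.
  move=> la; rewrite lee_fin /bounded_weight.
  by case: ifP => // _; rewrite sur_weight_ge0.
rewrite -(col_factor_fixpoint a0) -sumEFin; apply: lee_sum => a _.
rewrite EFinM; apply: le_trans (lee_wpmul2l _ (IH a)); last first.
  by rewrite lee_fin col_factor_ge0.
rewrite -esumZl ?col_factor_ge0 //; last first.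
  by move=> la; rewrite /bounded_weight; case: ifP => // _; rewrite sur_weight_ge0.
rewrite le_esum // => la /= le_a; rewrite lee_fin /bounded_weight.
rewrite -{1}addcol0 sur_weight_addcol // /addcol_seq all_cat all_map all_nseq /=.
by rewrite orbT andbT (eq_all (a2 := leq^~ N)) //; case: ifP; rewrite ?mulr0.
Qed.

Local Notation T a mu :=
  (\esum_(la in [set la : intpart | (size la <= a)%N]) (sur_weight a mu la)%:E).

(** A finite partial sum meets only partitions with a bounded number of columns. *)
Lemma esum_weight_le a : (T a empty_intpart <= (V a)%:E)%E.
Proof.
apply: ge_ereal_sup => _ [X [finX XS] <-].
pose N := (\max_(la <- finmap.enum_fset (fset_set X)) psize la)%N.
apply: le_trans (bounded_weight_le N a); apply: esum_ge; exists X => //.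
apply: lee_fsum => // la Xla; rewrite lee_fin /bounded_weight ifT //.
apply/allP => j jla; apply: leq_trans (leq_bigmax_seq (F := psize) la _ _) => //.
  by rewrite /psize sumnE (big_rem j) //= leq_addr.
by rewrite in_fset_set // mem_set.
Qed.

Lemma esum_weight_col a0 b mu : (size mu <= b)%N ->
    (forall a, T a mu \is a fin_num) ->
  T a0 (addcol b mu) =
  (\sum_(a < a0.+1) col_factor a0 a b (size mu) * fine (T a mu))%:E.
Proof.
move=> le_b fT; rewrite esum_columns; last by move=> la; rewrite lee_fin sur_weight_ge0.
rewrite -sumEFin; apply: eq_bigr => a _; rewrite EFinM fineK //.
have [ca|ac] := leqP (size mu) a.
  rewrite -esumZl ?col_factor_ge0 //; last exact: sur_weight_ge0.
  by apply: eq_esum => la /= le_a; rewrite sur_weight_addcol.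
(* For a < size mu the column factor may be negative, but all the weights are zero. *)
rewrite !esum1 ?mule0 // => la /= le_a.
  by rewrite sur_weight_eq0 // (leq_ltn_trans le_a).
rewrite sur_weight_addcol // [X in _ * X]sur_weight_eq0 ?mulr0 //.
exact: leq_ltn_trans le_a ac.
Qed.

(** The totals are finite and satisfy the same triangular system as [V]. Its diagonal coefficient
    u^a0 / p^(a0^2) is below 1 for a0 > 0, so subtracting the equations leaves (1 - k) x = (1 - k)
    v. At a0 = 0 the coefficient is 1, and only the empty partition occurs. *)
Lemma esum_weight0 a0 : T a0 empty_intpart = (V a0)%:E.
Proof.
have fT a : T a empty_intpart \is a fin_num.
  rewrite ge0_fin_numE; last by apply: esum_ge0 => la _; rewrite lee_fin sur_weight_ge0.
  by apply: le_lt_trans (esum_weight_le a) _; rewrite ltry.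
rewrite -(fineK (fT a0)); congr EFin.
have [n] := ubnP a0; elim: n a0 => // n IH a0 a0n.
have [a00|a00] := posnP a0.
  rewrite a00 !poch0 mulr1 invr1.
  rewrite (_ : T 0 empty_intpart = \esum_(la in [set empty_intpart])
    (sur_weight 0 empty_intpart la)%:E).
    by rewrite esum_set1 ?lee_fin ?sur_weight_ge0 //= sur_weight0 poch0 invr1.
  congr (esum _ _); apply/seteqP; split=> la /=; last by move=> ->.
  by rewrite leqn0 => /nilP la0; apply: val_inj.
have := congr1 fine (@esum_weight_col a0 0 empty_intpart isT fT); rewrite addcol0 /=.
have := col_factor_fixpoint a0; rewrite !big_ord_recr /=.
have -> : \sum_(i < a0) col_factor a0 i 0 0 * fine (T i empty_intpart) =
          \sum_(i < a0) col_factor a0 i 0 0 * V i.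
  by apply: eq_bigr => i _; rewrite IH // (leq_trans (ltn_ord i)).
set s := \sum_(i < a0) _; set x := fine _; set k := col_factor _ _ _ _.
set v := (_ * poch p (u / p) a0)^-1.
have k1 : k < 1.
  rewrite /k /col_factor big_ord0 muln0 subnn poch0 expr0 !mulr1.
  rewrite ltr_pdivrMr ?exprn_gt0 // mul1r -mulnn exprM.
  apply: (@lt_le_trans _ _ (p ^+ a0)); first by rewrite ltrXn2r ?nnegrE ?ltW // -lt0n.
  by rewrite -exprM ler_eXn2l // leq_pmulr.
move=> vE xE; apply: (mulfI (lt0r_neq0 (_ : 0 < 1 - k))); first by rewrite subr_gt0.
by rewrite !mulrBl !mul1r -[in LHS]/x {1}xE -{1}vE; ring.
Qed.

(** A nonempty [mu] loses a column in [esum_weight_col], so the recursion is explicit and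
    [column_identity] sums it. *)
Lemma esum_weight mu a0 : T a0 mu =
  (if (size mu <= a0)%N then
     u ^+ psize mu / (poch p (1 / p) (a0 - size mu) * poch p (u / p) a0) else 0)%:E.
Proof.
elim/intpart_ind: mu a0 => [|b mu b0 le_b IH] a0.
  by rewrite esum_weight0 /= subn0 expr0; congr EFin; rewrite [RHS]mul1r.
rewrite size_addcol //; case: leqP => [ba|ab]; last first.
  rewrite esum1 // => la /= le_a; rewrite sur_weight_eq0 //.
  rewrite -[size (addcol_seq _ _)]/(size (addcol b mu)) size_addcol //.
  exact: leq_ltn_trans le_a ab.
rewrite esum_weight_col //; last by move=> a; rewrite IH.
congr EFin; have := @column_identity R p hp u hup a0 b (size mu).
rewrite le_b ba => /(_ isT) cE.
rewrite psize_addcol // exprD [u ^+ b * _]mulrC -mulrA -cE mulr_sumr.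
apply: eq_bigr => a _; rewrite IH /= -/(col_factor a0 a b (size mu)).
by case: ifP; rewrite ?mulr0 // => _; rewrite mulrCA.
Qed.

(** * The measure P_{d,u} and its moments *)

Variable d : nat.

Lemma pochD_prod r : (r <= d)%N ->
  poch p (1 / p) (d - r) * \prod_((d - r).+1 <= i < d.+1) (1 - 1 / p ^+ i)
  = poch p (1 / p) d.
Proof.
move=> rd; have pE n : poch p (1 / p) n = \prod_(1 <= i < n.+1) (1 - 1 / p ^+ i).
  rewrite /poch [RHS]big_add1 /=; apply: eq_bigr => i _.
  by rewrite exprS !div1r invfM.
by rewrite !pE -big_cat_nat //= ltnS leq_subr.
Qed.

Lemma PduE la : Pdu p u d la = if (size la <= d)%N then
  poch p (u / p) d * poch p (1 / p) d
   * (u ^+ psize la / (card_aut p la * poch p (1 / p) (d - size la))) else 0.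
Proof.
rewrite /Pdu prankE; case: ifP => // led.
rewrite -(pochD_prod led).
have -> : \prod_(1 <= i < d.+1) (1 - u / p ^+ i) = poch p (u / p) d.
  by rewrite /poch big_add1 /=; apply: eq_bigr => i _; rewrite exprS invfM mulrA.
by field; rewrite poch1_neq0 //= lt0r_neq0 // card_aut_gt0.
Qed.

Lemma Pdu_ge0 la : 0 <= Pdu p u d la.
Proof.
rewrite PduE; case: ifP => // _.
have pu := ltW (poch_gt0 hp d hup); have au := ltW (card_aut_gt0 hp la).
have pt n := ltW (poch1_gt0 hp n).
apply: mulr_ge0; first exact: mulr_ge0.
by apply: divr_ge0; [rewrite exprn_ge0 // ltW|apply: mulr_ge0].
Qed.

Lemma Pdu_moments mu :
  \esum_(la in [set: intpart]) (Pdu p u d la * card_sur p la mu)%:E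
  = (sur_moment p u d mu)%:E.
Proof.
transitivity ((poch p (u / p) d * poch p (1 / p) d)%:E * T d mu)%E.
  rewrite -esumZl; last exact: sur_weight_ge0; last first.
    by rewrite mulr_ge0 ?ltW ?poch_gt0.
  rewrite esum_mkcond [RHS]esum_mkcond; apply: eq_esum => la _.
  rewrite mem_set // PduE card_sur_inj_count //; case: ifP => [led|nled].
    by rewrite mem_set //; congr EFin; rewrite /sur_weight; ring.
  by rewrite memNset ?mul0r //= nled.
rewrite esum_weight -EFinM; congr EFin; rewrite /sur_moment prankE.
case: ifP => _; last by rewrite mulr0.
by field; rewrite poch1_neq0 //= lt0r_neq0 // poch_gt0.
Qed.

(** The diagonal term is the same fraction of the moment for every [mu], which makes the contraction
    factor uniform. *)
Lemma Pdu_card_aut mu :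
  Pdu p u d mu * card_aut p mu = poch p (u / p) d * sur_moment p u d mu.
Proof.
rewrite PduE /sur_moment prankE; case: ifP => _; last by rewrite mul0r mulr0.
by field; rewrite poch1_neq0 //= lt0r_neq0 // card_aut_gt0.
Qed.

End column_sums.

(** * Uniqueness from moments with a dominant diagonal *)

Section uniqueness.
Import numFieldNormedType.Exports.
Variables (R : realType) (I : choiceType) (S : I -> I -> R) (M f g : I -> R) (C : R).
Hypotheses (S0 : forall i j, 0 <= S i j) (Sii : forall i, 0 < S i i).
Hypotheses (f0 : forall i, 0 <= f i) (g0 : forall i, 0 <= g i).
Hypothesis fM : forall j, \esum_(i in [set: I]) (f i * S i j)%:E = (M j)%:E.
Hypothesis gM : forall j, \esum_(i in [set: I]) (g i * S i j)%:E = (M j)%:E.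
Hypotheses (C0 : 0 < C) (C2 : C^-1 < 2) (gC : forall j, g j * S j j = C * M j).

Let offdiag (h : I -> R) j := \esum_(i in ~` [set j]) (h i * S i j)%:E.

Lemma offdiagE (h : I -> R) j : (forall i, 0 <= h i) ->
    \esum_(i in [set: I]) (h i * S i j)%:E = (M j)%:E ->
  exists2 x, offdiag h j = x%:E & 0 <= x /\ M j = h j * S j j + x.
Proof.
move=> h0 hM; have hS0 i : (0%:E <= (h i * S i j)%:E)%E by rewrite lee_fin mulr_ge0.
move: hM; rewrite (esumID [set j]) // !setTI esum_set1 // -/(offdiag h j).
have : (0 <= offdiag h j)%E by apply: esum_ge0.
by case: (offdiag h j) => [x|//|//] x0 [<-]; exists x.
Qed.

(** As f and g have equal moments, their diagonal terms differ by as much as their off-diagonal sums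
    F and G do. *)
Lemma moments_contract K : 0 <= K ->
    (forall j, `|f j - g j| * S j j <= K * M j) ->
  forall j, `|f j - g j| * S j j <= K * (C^-1 - 1) * M j.
Proof.
move=> K0 HK j.
have [F FE [F0 fF]] := offdiagE f0 (fM j); have [G GE [G0 gG]] := offdiagE g0 (gM j).
(* Since [M i] is [g i * S i i / C], the assumed bound compares the defect with g itself and can be
   summed off the diagonal. *)
have fg i : `|f i - g i| <= K / C * g i.
  rewrite -(ler_pM2r (Sii i)) (le_trans (HK i)) // -!mulrA gC mulKf //.
  exact: lt0r_neq0.
have KC : 0 <= K / C by rewrite divr_ge0 // ltW.
have leFG : F <= G + K / C * G.
  have : (F%:E <= G%:E + (K / C)%:E * G%:E)%E.
    rewrite -FE -GE /offdiag -esumZl //; last by move=> i; rewrite mulr_ge0.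
    rewrite -esumD => [|i _|i _]; last 2 first.
    - by rewrite lee_fin mulr_ge0.
    - by rewrite lee_fin (mulr_ge0 KC) ?mulr_ge0.
    apply: le_esum => i _; rewrite -EFinD lee_fin mulrA -mulrDl ler_wpM2r //.
    by have := fg i; have := ler_norm (f i - g i); lra.
  by rewrite lee_fin.
have leGF : G <= F + K / C * G.
  have : (G%:E <= F%:E + (K / C)%:E * G%:E)%E.
    rewrite -FE -GE /offdiag -esumZl //; last by move=> i; rewrite mulr_ge0.
    rewrite -esumD => [|i _|i _]; last 2 first.
    - by rewrite lee_fin mulr_ge0.
    - by rewrite lee_fin (mulr_ge0 KC) ?mulr_ge0.
    apply: le_esum => i _; rewrite -EFinD lee_fin mulrA -mulrDl ler_wpM2r //.
    by have := fg i; have := lerNnormlW (lexx `|f i - g i|); lra.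
  by rewrite lee_fin.
(* The diagonal takes the share C of [M j] and leaves G = (1 - C) M j. *)
have GM : K / C * G = K * (C^-1 - 1) * M j.
  have -> : G = (1 - C) * M j by have := gC j; lra.
  by field; rewrite lt0r_neq0.
rewrite -GM -(gtr0_norm (Sii j)) -normrM mulrBl ler_norml; lra.
Qed.

(* The defect [|f - g| S_jj / M_j] is at most 1 and is multiplied by a factor
   [C^-1 - 1 < 1] at each application of [moments_contract]. *)
Lemma moments_unique : f =1 g.
Proof.
move=> j.
have [F _ [F0 fF]] := offdiagE f0 (fM j); have [G _ [G0 gG]] := offdiagE g0 (gM j).
have M0 i : 0 <= M i.
  have [x _ [x0 ->]] := offdiagE f0 (fM i); by rewrite addr_ge0 ?mulr_ge0.
suff : `|f j - g j| * S j j <= 0.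
  rewrite pmulr_lle0 // normr_le0 subr_eq0 => /eqP //.
have [Mj0|Mj] := eqVneq (M j) 0.
  have fS : 0 <= f j * S j j by rewrite mulr_ge0.
  have gS : 0 <= g j * S j j by rewrite mulr_ge0.
  by rewrite -(gtr0_norm (Sii j)) -normrM mulrBl ler_norml; lra.
have {}Mj : 0 < M j by rewrite lt_neqAle eq_sym Mj M0.
have C1 : C <= 1 by rewrite -(ler_pM2r Mj) mul1r; have := gC j; lra.
pose c := C^-1 - 1.
have c0 : 0 <= c by rewrite subr_ge0 invf_ge1.
(* For n = 0, both diagonal terms lie between 0 and [M i]. *)
have Hn n i : `|f i - g i| * S i i <= c ^+ n * M i.
  elim: n i => [|n IH] i; last first.
    by rewrite exprSr; apply: moments_contract; rewrite ?exprn_ge0.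
  have [F' _ [F'0 fF']] := offdiagE f0 (fM i).
  have [G' _ [G'0 gG']] := offdiagE g0 (gM i).
  have fS : 0 <= f i * S i i by rewrite mulr_ge0.
  have gS : 0 <= g i * S i i by rewrite mulr_ge0.
  rewrite expr0 mul1r -(gtr0_norm (Sii i)) -normrM mulrBl ler_norml; lra.
have c1 : `|c| < 1 by rewrite ger0_norm // /c; move: C2; lra.
have cvg0 : (c ^+ n * M j) @[n --> \oo] --> 0 * M j.
  by apply: cvgMl; exact: cvg_expr.
rewrite -(mul0r (M j)); apply: (cvgr_to_ge cvg0).
by apply: nearW => n; exact: Hn.
Qed.

End uniqueness.

(** * Measures on partitions and the conclusion *)

(** [pickle] is injective, so its fibres cut [A] into a sequence of singletons and empty sets, to
    which countable additivity applies. *)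
Lemma discrete_measure_esum (R : realType) (nu : {measure set intpart -> \bar R})
    (A : set intpart) :
  nu A = \esum_(la in A) nu [set la].
Proof.
pose F n := [set la : intpart | A la /\ pickle la = n].
have tF : trivIset [set: nat] F.
  by move=> i j _ _ [la [[_ <-] [_ <-]]].
have AE : A = \bigcup_(n in [set: nat]) F n.
  by apply/seteqP; split=> [la Ala|la [n _ []] //]; exists (pickle la).
rewrite {1}AE measure_bigcup //.
rewrite [in RHS]AE esum_bigcupT // -nneseries_esumT; last first.
  by move=> n; exact: esum_ge0.
rewrite (@eq_eseriesl _ _ xpredT); last by move=> n; rewrite in_setT.
apply: eq_eseriesr => n _.
have [[la [Ala pn]]|nF] := pselect (exists la, F n la).
  have -> : F n = [set la].
    apply/seteqP; split=> [x [_ /= xn]|x -> //].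
    by apply: (pcan_inj pickleK); rewrite xn pn.
  by rewrite esum_set1.
have -> : F n = set0 by apply/seteqP; split=> x // Fx; apply: nF; exists x.
by rewrite measure0 esum_set0.
Qed.

Theorem theorem5p6 (R : realType) (p u : R) (d : nat)
    (hp : 1 < p) (hu0 : 0 < u) (hup : u < p) (hd : (0 < d)%N)
    (hlt2 : 1 / poch p (u / p) d < 2)
    (nu : probability intpart R)
    (hmom : forall mu : intpart,
      (\esum_(la in [set: intpart]) (nu [set la] * (card_sur p la mu)%:E))%E
      = (sur_moment p u d mu)%:E) :
  forall A : set intpart, nu A = (\esum_(la in A) (Pdu p u d la)%:E)%E.
Proof.
(* It suffices to compare point masses, which are finite because nu is a probability. *)
move=> A; rewrite discrete_measure_esum; apply: eq_esum => la _.
have fnu x : nu [set x] \is a fin_num by exact: fin_num_measure.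
transitivity (fine (nu [set la]))%:E; first exact/esym/fineK.
congr EFin; move: la.
apply: (@moments_unique R _ (card_sur p) (sur_moment p u d) _ _ (poch p (u / p) d)).
- by move=> i j; apply: card_sur_ge0.
- by move=> i; rewrite card_sur_self // card_aut_gt0.
- by move=> i; rewrite fine_ge0.
- by move=> i; apply: Pdu_ge0.
- move=> j; rewrite -hmom; apply: eq_esum => i _.
  by rewrite EFinM fineK.
- by move=> j; apply: Pdu_moments.
- exact: poch_gt0.
- by rewrite -div1r.
- by move=> j; rewrite card_sur_self // Pdu_card_aut.
Qed.
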